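(* Let $A$ be a Noetherian ring, $R=A[[x]]$, $x=(x_1,\dots,x_n)$, and $M$ a finitely generated $R$-module admitting a presentation $$R^p\xrightarrow{\,T\,}R^q\to M\to0$$ with algebraic presentation matrix $T=(t_{ij})$, i.e. $t_{ij}\in A[x]$ or, more generally, $t_{ij}\in A\langle x\rangle$. Fix $\mathfrak p\in\operatorname{Spec}A$ with $\hat d_{\mathfrak p}(M)<\infty$. Then there is an open neighbourhood $U$ of $\mathfrak p$ in $\operatorname{Spec}A$ such that $$\hat d_{\mathfrak q}(M)\le\hat d_{\mathfrak p}(M)\quad\text{for all }\mathfrak q\in U.$$
   Context: Rings are commutative with unit. $R=A[[x_1,\dots,x_n]]$ is the formal power series ring and $\langle x\rangle=\langle x_1,\dots,x_n\rangle$. For $\mathfrak p\in\operatorname{Spec}A$ let $k(\mathfrak p)=A_{\mathfrak p}/\mathfrak pA_{\mathfrak p}$. For an $R$-module $M$ the completed fibre over $\mathfrak p$ is $$\hat M(\mathfrak p):=\varprojlim_m\big((M/\langle x\rangle^mM)\otimes_A k(\mathfrak p)\big),$$ and $\hat d_{\mathfrak p}(M):=\dim_{k(\mathfrak p)}\hat M(\mathfrak p)\in\mathbb N\cup\{\infty\}$. $A\langle x\rangle$, the ring of algebraic power series over $A$, is the Henselization of the polynomial ring $A[x]$ with respect to the ideal $\langle x\rangle$, i.e. $A\langle x\rangle=\varinjlim B$ over all étale ring maps $A[x]\to B$ inducing an isomorphism $A[x]/\langle x\rangle\cong B/\langle x\rangle B$. For $A$ Noetherian it is regarded as a subring of its $\langle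 x\rangle$-adic completion $A[[x]]$. *)

(* Defs.v *)
From HB Require Import structures.
From mathcomp Require Import all_boot all_order all_algebra.
From mathcomp Require Import generic_quotient ring_quotient ring.
From mathcomp.multinomials Require Import freeg mpoly.
From mathcomp Require Import boolp classical_sets constructive_ereal.
From mathcomp Require Import topology_structure.

Set Implicit Arguments.
Unset Strict Implicit.
Unset Printing Implicit Defensive.

Import GRing.Theory.
Local Open Scope quotient_scope.
Local Open Scope classical_set_scope.
Local Open Scope ring_scope.

Section Span.
Context {R : pzRingType} {V : lmodType R}.
Implicit Types (S : set V) (u v : V).

Definition span S : {pred V} := fun v =>
  `[< exists k (c : 'I_k -> R) (s : 'I_k -> V),
        (forall i, S (s i)) /\ v = \sum_i c i *: s i >].

Lemma spanP S v : reflect (exists k (c : 'I_k -> R) (s : 'I_k -> V),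
  (forall i, S (s i)) /\ v = \sum_i c i *: s i) (v \in span S).
Proof. exact: asboolP. Qed.

Lemma mem_span S v : S v -> v \in span S.
Proof.
move=> Sv; apply/spanP; exists 1%N, (fun=> 1), (fun=> v); split=> //.
by rewrite big_ord1 scale1r.
Qed.

Lemma span_submod_closed S : submod_closed (span S).
Proof.
split=> [|a u v /spanP[k [c [s [Ss ->]]]] /spanP[l [d [t [St ->]]]]].
  apply/spanP; exists 0%N, (fun=> 0), (fun=> 0); rewrite big_ord0.
  by split=> // -[].
apply/spanP; exists (k + l)%N,
  (fun i => match split i with inl i => a * c i | inr i => d i end),
  (fun i => match split i with inl i => s i | inr i => t i end); split.
  by move=> i; case: (split i) => j; [exact: Ss | exact: St].
rewrite big_split_ord /= scaler_sumr; congr (_ + _); apply: eq_bigr => i _.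
  by rewrite (unsplitK (inl i)) scalerA.
by rewrite (unsplitK (inr i)).
Qed.

HB.instance Definition _ S := GRing.isSubmodClosed.Build R V (span S)
  (span_submod_closed S).

Lemma span_ind S (P : V -> Prop) : P 0 -> (forall u v, P u -> P v -> P (u + v)) ->
  (forall c s, S s -> P (c *: s)) -> forall v, v \in span S -> P v.
Proof.
move=> P0 PD PZ v /spanP[k [c [s [Ss ->]]]].
by elim/big_ind: _ => // i _; exact: PZ.
Qed.

Lemma sub_span S (N : V -> Prop) : N 0 -> (forall u v, N u -> N v -> N (u + v)) ->
  (forall c v, N v -> N (c *: v)) -> (forall s, S s -> N s) ->
  forall v, v \in span S -> N v.
Proof. by move=> N0 ND NZ SN; apply: span_ind => // c s /SN; exact: NZ. Qed.

End Span.

Section QuotMod.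
Context {R : pzRingType} {V : lmodType R} (S : set V).

(* The quotient of V by the submodule generated by S. *)
Definition quotmod : Type := @Quotient.quot V (span S).

HB.instance Definition _ := GRing.Zmodule.on quotmod.
HB.instance Definition _ := EqQuotient.on quotmod.

Definition qproj (v : V) : quotmod := \pi_quotmod v.

Lemma qprojP u v : (qproj u = qproj v) <-> (u - v \in span S).
Proof.
split=> [/eqP|h]; first by rewrite /qproj piE.
by apply/eqP; rewrite /qproj piE.
Qed.

Lemma qprojK x : qproj (repr x) = x. Proof. exact: reprK. Qed.

Lemma qproj_ind (P : quotmod -> Prop) : (forall v, P (qproj v)) -> forall x, P x.
Proof. by move=> h x; rewrite -[x]qprojK. Qed.

Lemma qprojD : {morph qproj : u v / u + v}.
Proof. by move=> u v; rewrite /qproj !piE. Qed.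

Definition qscale (a : R) (x : quotmod) : quotmod := qproj (a *: repr x).

Lemma qprojZ a v : qproj (a *: v) = qscale a (qproj v).
Proof.
apply/qprojP; rewrite -scalerBr rpredZ //.
by apply/qprojP; rewrite qprojK.
Qed.

Fact qscaleA a b x : qscale a (qscale b x) = qscale (a * b) x.
Proof. by elim/qproj_ind: x => v; rewrite -!qprojZ scalerA. Qed.
Fact qscale1 x : qscale 1 x = x.
Proof. by elim/qproj_ind: x => v; rewrite -!qprojZ scale1r. Qed.
Fact qscaleDr a x y : qscale a (x + y) = qscale a x + qscale a y.
Proof.
elim/qproj_ind: x => u; elim/qproj_ind: y => v.
by rewrite -qprojD -!qprojZ -qprojD scalerDr.
Qed.
Fact qscaleDl x a b : qscale (a + b) x = qscale a x + qscale b x.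
Proof. by elim/qproj_ind: x => v; rewrite -!qprojZ -qprojD scalerDl. Qed.

HB.instance Definition _ := GRing.Zmodule_isLmodule.Build R quotmod
  qscaleA qscale1 qscaleDr qscaleDl.

Fact qproj_linear : linear qproj.
Proof. by move=> a u v; rewrite qprojD qprojZ. Qed.
HB.instance Definition _ := GRing.isLinear.Build R V quotmod *:%R qproj
  qproj_linear.

Section Lift.
Context {W : lmodType R} (f : {linear V -> W}).
Hypothesis fS : forall s, S s -> f s = 0.

Definition qlift of (forall s, S s -> f s = 0) : quotmod -> W :=
  fun x => f (repr x).

Lemma qliftE v : qlift fS (qproj v) = f v.
Proof.
apply/eqP; rewrite -subr_eq0 -linearB; apply/eqP.
have: repr (qproj v) - v \in span S by apply/qprojP; rewrite qprojK.
apply: (@sub_span _ _ S (fun w => f w = 0)) => [|x y fx fy|c x fx|//].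
- exact: linear0.
- by rewrite linearD fx fy addr0.
- by rewrite linearZ /= fx scaler0.
Qed.

Fact qlift_linear : linear (qlift fS).
Proof.
move=> a x y; elim/qproj_ind: x => u; elim/qproj_ind: y => v.
by rewrite -linearP !qliftE linearP.
Qed.
HB.instance Definition _ := GRing.isLinear.Build R quotmod W *:%R (qlift fS)
  qlift_linear.

End Lift.
End QuotMod.
Arguments quotmod {R V} S.
Arguments qproj {R V} S v.
Arguments qlift {R V S W} f.

Definition restr (A B : pzRingType) (f : {rmorphism A -> B}) (N : lmodType B) :
  Type := N.

Section RestrictionOfScalars.
Context {A B : pzRingType} (f : {rmorphism A -> B}) (N : lmodType B).

HB.instance Definition _ := GRing.Zmodule.on (restr f N).

Definition restr_scale (a : A) (v : restr f N) : restr f N := f a *: (v : N).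

Fact restr_scaleA a b v : restr_scale a (restr_scale b v) = restr_scale (a * b) v.
Proof. by rewrite /restr_scale scalerA rmorphM. Qed.
Fact restr_scale1 v : restr_scale 1 v = v.
Proof. by rewrite /restr_scale rmorph1 scale1r. Qed.
Fact restr_scaleDr a u v :
  restr_scale a (u + v) = restr_scale a u + restr_scale a v.
Proof. exact: scalerDr. Qed.
Fact restr_scaleDl v a b :
  restr_scale (a + b) v = restr_scale a v + restr_scale b v.
Proof. by rewrite /restr_scale rmorphD scalerDl. Qed.

HB.instance Definition _ := GRing.Zmodule_isLmodule.Build A (restr f N)
  restr_scaleA restr_scale1 restr_scaleDr restr_scaleDl.

End RestrictionOfScalars.

Section RestrMap.
Context {A B : pzRingType} (f : {rmorphism A -> B}) {N N' : lmodType B}.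

Definition restr_map (h : {linear N -> N'}) : restr f N -> restr f N' := h.

Fact restr_map_linear h : linear (restr_map h).
Proof.
move=> a u v; rewrite /restr_map [LHS](@linearD _ _ _ _ h).
by congr (_ + _); exact: (@linearZ_LR _ _ _ _ h).
Qed.
HB.instance Definition _ h := GRing.isLinear.Build A (restr f N) (restr f N') *:%R
  (restr_map h) (restr_map_linear h).

End RestrMap.
Arguments restr_map {A B} f {N N'} h.

Section Tensor.
Context {A K : comNzRingType} (g : {rmorphism A -> K}) (N : lmodType A).

(* The tensor product over A of the A-module N and the A-algebra K, as a
   K-module: generated over K by the symbols n (x) k, subject to additivity in
   each argument, A-balancedness, and K acting on the second factor. *)
Inductive tensor_rel : {freeg (N * K) / K} -> Prop :=
| tensor_addl n n' k : tensor_rel (<< (n + n', k) >> - (<< (n, k) >> + << (n', k) >>))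
| tensor_addr n k k' : tensor_rel (<< (n, k + k') >> - (<< (n, k) >> + << (n, k') >>))
| tensor_bal a n k : tensor_rel (<< (a *: n, k) >> - << (n, g a * k) >>)
| tensor_scale c n k : tensor_rel (<< (n, c * k) >> - c *: << (n, k) >>).

Definition tensor : Type := quotmod tensor_rel.
HB.instance Definition _ := GRing.Lmodule.on tensor.

Definition tens (n : N) (k : K) : tensor := qproj tensor_rel << (n, k) >>.

Lemma tensDl k : {morph tens^~ k : n n' / n + n'}.
Proof.
move=> n n'; rewrite /tens -raddfD; apply/qprojP.
exact/mem_span/tensor_addl.
Qed.

Lemma tensDr n : {morph tens n : k k' / k + k'}.
Proof.
move=> k k'; rewrite /tens -raddfD; apply/qprojP.
exact/mem_span/tensor_addr.
Qed.

Lemma tens_bal a n k : tens (a *: n) k = tens n (g a * k).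
Proof. by apply/qprojP/mem_span/tensor_bal. Qed.

Lemma tensZ c n k : tens n (c * k) = c *: tens n k.
Proof. by rewrite /tens -linearZ; apply/qprojP/mem_span/tensor_scale. Qed.

Lemma tensor_ind (P : tensor -> Prop) : P 0 ->
  (forall x y, P x -> P y -> P (x + y)) -> (forall n k, P (tens n k)) ->
  forall x, P x.
Proof.
move=> P0 PD Pt; have PU c z : P (qproj tensor_rel << c *g z >>).
  have -> : << c *g z >> = c *: << z >> :> {freeg (N * K) / K}.
    by apply/eqP/freeg_eqP => y; rewrite coeffZ !coeffU mul1r.
  case: z => n k; rewrite linearZ /= -[X in c *: X]/(tens n k) -tensZ.
  exact: Pt.
apply: qproj_ind => v; rewrite -[v]freeg_sumE raddf_sum.
by elim/big_ind: _ => // z _; exact: PU.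
Qed.

Section Lift.
Context {W : lmodType K} (b : N -> K -> W).
Hypothesis bDl : forall k, {morph b^~ k : n n' / n + n'}.
Hypothesis bDr : forall n, {morph b n : k k' / k + k'}.
Hypothesis bbal : forall a n k, b (a *: n) k = b n (g a * k).
Hypothesis bZ : forall c n k, b n (c * k) = c *: b n k.

Definition tensor_lift0 (v : {freeg (N * K) / K}) : W :=
  fglift (fun z => b z.1 z.2) v.

Fact tensor_lift0_linear : linear tensor_lift0.
Proof.
have fD : {morph tensor_lift0 : u v / u + v}.
  pose pm := GRing.isZmodMorphism.Build _ _ tensor_lift0 (lift_is_additive _).
  pose pa : {additive {freeg (N * K) / K} -> W} := HB.pack tensor_lift0 pm.
  exact: (raddfD pa).
move=> a u v; rewrite fD; congr (_ + _).
have f0 : tensor_lift0 0 = 0.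
  by apply: (@addIr _ (tensor_lift0 0)); rewrite -fD !add0r.
rewrite -[u]freeg_sumE; elim/big_rec: _ => [|z w _ IH].
  by rewrite scaler0 f0 scaler0.
rewrite scalerDr !fD scalerDr IH; congr (_ + _).
have -> : a *: << coeff z u *g z >>
    = << a * coeff z u *g z >> :> {freeg (N * K) / K}.
  by apply/eqP/freeg_eqP => y; rewrite coeffZ !coeffU mulrA.
by rewrite /tensor_lift0 !liftU scalerA.
Qed.
HB.instance Definition _ := GRing.isLinear.Build K {freeg (N * K) / K} W *:%R
  tensor_lift0 tensor_lift0_linear.

Fact tensor_lift0U z : tensor_lift0 << z >> = b z.1 z.2.
Proof. by rewrite /tensor_lift0 liftU scale1r. Qed.

Fact tensor_lift0_rel t : tensor_rel t -> tensor_lift0 t = 0.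
Proof.
have fB u v : tensor_lift0 u = tensor_lift0 v -> tensor_lift0 (u - v) = 0.
  by move=> uv; rewrite linearB /= uv subrr.
case=> [n n' k|n k k'|a n k|c n k]; apply: fB;
  rewrite ?linearD ?linearZ /= !tensor_lift0U /=.
- exact: bDl.
- exact: bDr.
- exact: bbal.
- exact: bZ.
Qed.

Definition tensor_lift : tensor -> W := qlift tensor_lift0 tensor_lift0_rel.
HB.instance Definition _ := GRing.Linear.on tensor_lift.

Lemma tensor_liftE n k : tensor_lift (tens n k) = b n k.
Proof. by rewrite /tensor_lift /tens qliftE /= tensor_lift0U. Qed.

End Lift.
End Tensor.

Section TensorMap.
Context {A K : comNzRingType} (g : {rmorphism A -> K}) {N N' : lmodType A}.
Context (h : {linear N -> N'}).

Let hb (n : N) (k : K) : tensor g N' := tens g (h n) k.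

Fact tensor_map_addl k : {morph hb^~ k : n n' / n + n'}.
Proof. by move=> n n'; rewrite /hb linearD tensDl. Qed.
Fact tensor_map_addr n : {morph hb n : k k' / k + k'}.
Proof. by move=> k k'; rewrite /hb tensDr. Qed.
Fact tensor_map_bal a n k : hb (a *: n) k = hb n (g a * k).
Proof. by rewrite /hb linearZ tens_bal. Qed.
Fact tensor_map_scale c n k : hb n (c * k) = c *: hb n k.
Proof. by rewrite /hb tensZ. Qed.

Definition tensor_map : tensor g N -> tensor g N' :=
  tensor_lift tensor_map_addl tensor_map_addr tensor_map_bal tensor_map_scale.
HB.instance Definition _ := GRing.Linear.on tensor_map.

Lemma tensor_mapE n k : tensor_map (tens g n k) = tens g (h n) k.
Proof. exact: tensor_liftE. Qed.

End TensorMap.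
Arguments tensor_map {A K} g {N N'} h.

Section InverseLimit.
Context {K : pzRingType} (F : nat -> lmodType K).
Context (t : forall m, {linear F m.+1 -> F m}).

Record invlim : Type := InvLim {
  invlim_val : forall m, F m;
  invlim_compat : forall m, t m (invlim_val m.+1) = invlim_val m }.

HB.instance Definition _ := gen_eqMixin invlim.
HB.instance Definition _ := gen_choiceMixin invlim.

Lemma invlim_eq (x y : invlim) : (forall m, invlim_val x m = invlim_val y m) -> x = y.
Proof.
case: x y => [x xP] [y yP] /= xy; have {}xy := functional_extensionality_dep xy.
case: _ / xy in yP *; congr InvLim; exact: Prop_irrelevance.
Qed.

Fact invlim0_compat m : t m (0 : F m.+1) = 0. Proof. exact: linear0. Qed.
Fact invlimN_compat (x : invlim) m :
  t m (- invlim_val x m.+1) = - invlim_val x m.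
Proof. by rewrite linearN invlim_compat. Qed.
Fact invlimD_compat (x y : invlim) m :
  t m (invlim_val x m.+1 + invlim_val y m.+1) = invlim_val x m + invlim_val y m.
Proof. by rewrite linearD !invlim_compat. Qed.
Fact invlimZ_compat (a : K) (x : invlim) m :
  t m (a *: invlim_val x m.+1) = a *: invlim_val x m.
Proof. by rewrite linearZ /= invlim_compat. Qed.

Definition invlim0 := @InvLim (fun m => 0) invlim0_compat.
Definition invlimN x := @InvLim (fun m => - invlim_val x m) (invlimN_compat x).
Definition invlimD x y :=
  @InvLim (fun m => invlim_val x m + invlim_val y m) (invlimD_compat x y).
Definition invlimZ a x := @InvLim (fun m => a *: invlim_val x m) (invlimZ_compat a x).

Fact invlim_addA : associative invlimD.
Proof. by move=> x y z; apply: invlim_eq => m /=; rewrite addrA. Qed.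
Fact invlim_addC : commutative invlimD.
Proof. by move=> x y; apply: invlim_eq => m /=; rewrite addrC. Qed.
Fact invlim_add0 : left_id invlim0 invlimD.
Proof. by move=> x; apply: invlim_eq => m /=; rewrite add0r. Qed.
Fact invlim_addN : left_inverse invlim0 invlimN invlimD.
Proof. by move=> x; apply: invlim_eq => m /=; rewrite addNr. Qed.
HB.instance Definition _ := GRing.isZmodule.Build invlim
  invlim_addA invlim_addC invlim_add0 invlim_addN.

Fact invlim_scaleA a b x : invlimZ a (invlimZ b x) = invlimZ (a * b) x.
Proof. by apply: invlim_eq => m /=; rewrite scalerA. Qed.
Fact invlim_scale1 x : invlimZ 1 x = x.
Proof. by apply: invlim_eq => m /=; rewrite scale1r. Qed.
Fact invlim_scaleDr a x y : invlimZ a (x + y) = invlimZ a x + invlimZ a y.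
Proof. by apply: invlim_eq => m /=; rewrite scalerDr. Qed.
Fact invlim_scaleDl x a b : invlimZ (a + b) x = invlimZ a x + invlimZ b x.
Proof. by apply: invlim_eq => m /=; rewrite scalerDl. Qed.
HB.instance Definition _ := GRing.Zmodule_isLmodule.Build K invlim
  invlim_scaleA invlim_scale1 invlim_scaleDr invlim_scaleDl.

End InverseLimit.

Section Dimension.
Context {K : fieldType} (V : lmodType K).

Definition is_basis d (e : 'I_d -> V) : Prop :=
  (forall c : 'I_d -> K, \sum_i c i *: e i = 0 -> forall i, c i = 0) /\
  (forall v, exists c : 'I_d -> K, v = \sum_i c i *: e i).

(* The dimension of a possibly infinite-dimensional vector space, valued in
   the natural numbers with +oo adjoined. *)
Definition vdim : \bar int :=
  xget +oo%E [set d%:Z%:E%E | d in [set d | exists e : 'I_d -> V, is_basis e]].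

End Dimension.

(* Not the library's type prime_idealr A of such predicates: its universe is too
   large to carry a topology. *)
Record Spec (A : comNzRingType) : Type := MkSpec {
  spec_pred : A -> bool;
  spec_idealr : idealr_closed spec_pred;
  spec_prime : prime_idealr_closed spec_pred }.

HB.instance Definition _ (A : comNzRingType) (P : Spec A) :=
  isIdealr.Build A (spec_pred P) (spec_idealr P).
HB.instance Definition _ (A : comNzRingType) (P : Spec A) :=
  isPrimeIdealrClosed.Build A (spec_pred P) (spec_prime (s:=P)).

Section Localization.
Context {A : comNzRingType} (P : Spec A).

Record denom : Type := Denom { den : A; denP : den \notin spec_pred P }.
HB.instance Definition _ := [isSub for den].
HB.instance Definition _ := [Choice of denom by <:].
Implicit Types (s t u : denom).

Fact denom1_subproof : 1 \notin spec_pred P. Proof. by rewrite idealr1. Qed.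
Definition denom1 : denom := Denom denom1_subproof.
Fact denomM_subproof s t : den s * den t \notin spec_pred P.
Proof. by rewrite prime_idealrM negb_or (denP s) (denP t). Qed.
Definition denomM s t : denom := Denom (denomM_subproof s t).

Lemma val_denom1 : den denom1 = 1. Proof. by []. Qed.
Lemma val_denomM s t : den (denomM s t) = den s * den t. Proof. by []. Qed.
Definition denomE := (val_denom1, val_denomM).

Definition loc_equiv (x y : A * denom) : bool :=
  `[< exists u, den u * (x.1 * den y.2 - y.1 * den x.2) = 0 >].

Fact loc_equiv_is_equiv : equiv_class_of loc_equiv.
Proof.
split=> [x|x y|y x z].
- by apply/asboolP; exists denom1; rewrite subrr mulr0.
- by apply/asboolP/asboolP => -[u Hu]; exists u; rewrite -opprB mulrN Hu oppr0.
- move=> /asboolP[u Hu] /asboolP[v Hv]; apply/asboolP.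
  exists (denomM (denomM u v) y.2); rewrite !denomE.
  transitivity (den v * den z.2 * (den u * (x.1 * den y.2 - y.1 * den x.2))
    + den u * den x.2 * (den v * (y.1 * den z.2 - z.1 * den y.2))); first by ring.
  by rewrite Hu Hv !mulr0 addr0.
Qed.

Canonical loc_equiv_equiv := EquivRelPack loc_equiv_is_equiv.
Canonical loc_equiv_encModRel := defaultEncModRel loc_equiv.

Definition localization : Type := {eq_quot loc_equiv}.
HB.instance Definition _ : EqQuotient _ loc_equiv localization :=
  EqQuotient.on localization.
HB.instance Definition _ := Choice.on localization.

Definition lfrac (a : A) (s : denom) : localization := \pi_localization (a, s).

Lemma lfracP a s b t :
  lfrac a s = lfrac b t <-> exists u, den u * (a * den t - b * den s) = 0.
Proof.
split=> [/eqP|h]; first by rewrite /lfrac piE => /asboolP.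
by apply/eqP; rewrite /lfrac piE; apply/asboolP.
Qed.

Lemma lfrac_ind (Q : localization -> Prop) :
  (forall a s, Q (lfrac a s)) -> forall x : localization, Q x.
Proof. by move=> h x; rewrite -[x]reprK; case: (repr x) => a s; apply: h. Qed.

Definition loc_add (x y : localization) : localization :=
  let: (a, s) := repr x in let: (b, t) := repr y in
  lfrac (a * den t + b * den s) (denomM s t).
Definition loc_opp (x : localization) : localization :=
  let: (a, s) := repr x in lfrac (- a) s.
Definition loc_mul (x y : localization) : localization :=
  let: (a, s) := repr x in let: (b, t) := repr y in
  lfrac (a * b) (denomM s t).

Lemma repr_lfrac a s : exists u,
  den u * ((repr (lfrac a s)).1 * den s - a * den (repr (lfrac a s)).2) = 0.
Proof.
by apply/lfracP; rewrite /lfrac -surjective_pairing reprK.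
Qed.

Lemma lfracD a s b t :
  loc_add (lfrac a s) (lfrac b t) = lfrac (a * den t + b * den s) (denomM s t).
Proof.
rewrite /loc_add; have [u] := repr_lfrac a s; have [v] := repr_lfrac b t.
case: (repr (lfrac a s)) => a' s' /=; case: (repr (lfrac b t)) => b' t' /= Hv Hu.
apply/lfracP; exists (denomM u v); rewrite !denomE.
transitivity (den v * den t * den t' * (den u * (a' * den s - a * den s'))
  + den u * den s * den s' * (den v * (b' * den t - b * den t'))); first by ring.
by rewrite Hu Hv !mulr0 addr0.
Qed.

Lemma lfracN a s : loc_opp (lfrac a s) = lfrac (- a) s.
Proof.
rewrite /loc_opp; have [u] := repr_lfrac a s.
case: (repr (lfrac a s)) => a' s' /= Hu; apply/lfracP; exists u.
transitivity (- (den u * (a' * den s - a * den s'))); first by ring.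
by rewrite Hu oppr0.
Qed.

Lemma lfracM a s b t : loc_mul (lfrac a s) (lfrac b t) = lfrac (a * b) (denomM s t).
Proof.
rewrite /loc_mul; have [u] := repr_lfrac a s; have [v] := repr_lfrac b t.
case: (repr (lfrac a s)) => a' s' /=; case: (repr (lfrac b t)) => b' t' /= Hv Hu.
apply/lfracP; exists (denomM u v); rewrite !denomE.
transitivity (den v * den t * b' * (den u * (a' * den s - a * den s'))
  + den u * den s' * a * (den v * (b' * den t - b * den t'))); first by ring.
by rewrite Hu Hv !mulr0 addr0.
Qed.

Lemma lfrac_eq a s b t : a * den t = b * den s -> lfrac a s = lfrac b t.
Proof. by move=> h; apply/lfracP; exists denom1; rewrite h subrr mulr0. Qed.

Local Ltac loc_ring := repeat elim/lfrac_ind => ? ?;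
  rewrite ?(lfracD, lfracN, lfracM); apply: lfrac_eq; rewrite /= ?denomE; ring.

Fact loc_addA : associative loc_add. Proof. loc_ring. Qed.
Fact loc_addC : commutative loc_add. Proof. loc_ring. Qed.
Fact loc_add0 : left_id (lfrac 0 denom1) loc_add. Proof. loc_ring. Qed.
Fact loc_addN : left_inverse (lfrac 0 denom1) loc_opp loc_add.
Proof. loc_ring. Qed.
HB.instance Definition _ := GRing.isZmodule.Build localization
  loc_addA loc_addC loc_add0 loc_addN.

Fact loc_mulA : associative loc_mul. Proof. loc_ring. Qed.
Fact loc_mulC : commutative loc_mul. Proof. loc_ring. Qed.
Fact loc_mul1 : left_id (lfrac 1 denom1) loc_mul. Proof. loc_ring. Qed.
Fact loc_mulDl : left_distributive loc_mul loc_add. Proof. loc_ring. Qed.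
Fact loc_1neq0 : lfrac 1 denom1 != 0.
Proof.
apply/eqP => /lfracP[u] /=; rewrite mul0r subr0 !mulr1 => u0.
by have := denP u; rewrite /= u0 idealr0.
Qed.
HB.instance Definition _ := GRing.Zmodule_isComNzRing.Build localization
  loc_mulA loc_mulC loc_mul1 loc_mulDl loc_1neq0.

Definition to_loc (a : A) : localization := lfrac a denom1.

Fact to_loc_zmod_morphism : zmod_morphism to_loc.
Proof.
move=> a b; rewrite /to_loc -[RHS]/(loc_add _ (loc_opp _)) lfracN lfracD.
by apply: lfrac_eq; rewrite /= ?denomE; ring.
Qed.
Fact to_loc_monoid_morphism : monoid_morphism to_loc.
Proof.
split=> // a b; rewrite /to_loc -[RHS]/(loc_mul _ _) lfracM.
by apply: lfrac_eq; rewrite /= ?denomE; ring.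
Qed.
HB.instance Definition _ := GRing.isZmodMorphism.Build A localization to_loc
  to_loc_zmod_morphism.
HB.instance Definition _ := GRing.isMonoidMorphism.Build A localization to_loc
  to_loc_monoid_morphism.

(* The extended ideal P A_P. *)
Definition max_ideal : {pred localization} :=
  span (to_loc @` [set a | a \in spec_pred P] : set (localization^o)).

Lemma max_idealP (x : localization) : reflect (exists a s, a \in spec_pred P /\ x = lfrac a s) (x \in max_ideal).
Proof.
apply: (iffP idP) => [|[a [s [aP ->]]]].
  apply: (@sub_span _ _ _ (fun x : localization^o =>
    exists a s, a \in spec_pred P /\ x = lfrac a s)).
  - by exists 0, denom1; rewrite idealr0.
  - move=> _ _ [a [s [aP ->]]] [b [t [bP ->]]].
    exists (a * den t + b * den s), (denomM s t); rewrite -lfracD; split=> //.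
    by rewrite rpredD // mulrC idealMr.
  - move=> c _ [a [s [aP ->]]]; elim/lfrac_ind: c => b t.
    by exists (b * a), (denomM t s); rewrite -lfracM idealMr.
  - by move=> _ [a aP <-]; exists a, denom1.
have -> : lfrac a s = lfrac 1 s *: (to_loc a : localization^o).
  rewrite /to_loc -[RHS]/(loc_mul _ _) lfracM; apply: lfrac_eq; rewrite /= ?denomE; ring.
by apply/rpredZ/mem_span; exists a.
Qed.

Fact max_ideal_closed : idealr_closed max_ideal.
Proof.
split; first exact: (@rpred0 _ (span _ : zmodClosed _)).
- apply/negP => /max_idealP[a [s [aP /lfracP[u /eqP]]]] /=.
  rewrite mul1r mulr1 mulrBr subr_eq0 => /eqP us.
  by have := denomM_subproof u s; rewrite us idealMr.
- move=> c x y xI yI; apply: (@rpredD _ (span _ : zmodClosed _)) => //.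
  exact: (@rpredZ _ (localization^o)).
Qed.
HB.instance Definition _ := isIdealr.Build localization max_ideal max_ideal_closed.

Definition residue_field : Type := {ideal_quot (max_ideal : idealr localization)}.
HB.instance Definition _ := GRing.ComNzRing.on residue_field.

Definition rproj (x : localization) : residue_field := \pi_residue_field x.
Fact rproj_zmod_morphism : zmod_morphism rproj.
Proof. by move=> x y; rewrite /rproj !piE. Qed.
Fact rproj_monoid_morphism : monoid_morphism rproj.
Proof. by split=> [|x y]; rewrite /rproj !piE. Qed.
HB.instance Definition _ := GRing.isZmodMorphism.Build localization residue_field
  rproj rproj_zmod_morphism.
HB.instance Definition _ := GRing.isMonoidMorphism.Build localization residue_field
  rproj rproj_monoid_morphism.

Lemma rproj_eq0 (x : localization) : (rproj x == 0) = (x \in max_ideal).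
Proof. by rewrite -[0](raddf0 rproj) /rproj piE /= Quotient.equivE subr0. Qed.

Definition residue_inv (x : residue_field) : residue_field :=
  if x == 0 then 0 else xget 0 [set y | y * x = 1].

Fact residue_mulVf x : x != 0 -> residue_inv x * x = 1.
Proof.
move=> x0; rewrite /residue_inv (negPf x0).
suff h : exists y, y * x = 1 by exact: (xgetPex 0 h).
move: x0; have -> : x = rproj (repr x) by rewrite /rproj reprK.
rewrite rproj_eq0; elim/lfrac_ind: (repr x) => a s aI.
have aP : a \notin spec_pred P by apply: contra aI => aP; apply/max_idealP; exists a, s.
exists (rproj (lfrac (den s) (Denom aP))).
rewrite -rmorphM -(rmorph1 rproj); congr rproj.
rewrite -[LHS]/(loc_mul _ _) lfracM -[RHS]/(lfrac 1 denom1).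
by apply: lfrac_eq; rewrite /= ?denomE; ring.
Qed.
Fact residue_inv0 : residue_inv 0 = 0.
Proof. by rewrite /residue_inv eqxx. Qed.
HB.instance Definition _ := GRing.ComNzRing_isField.Build residue_field
  residue_mulVf residue_inv0.

Definition to_residue : A -> residue_field := rproj \o to_loc.
HB.instance Definition _ := GRing.RMorphism.on to_residue.

Lemma to_residue_eq0 a : (to_residue a == 0) = (a \in spec_pred P).
Proof.
rewrite rproj_eq0; apply/max_idealP/idP => [[b [s [bP /lfracP[u /eqP]]]]|aP].
  rewrite /= mulr1 mulrBr subr_eq0 => /eqP uas.
  have : den u * (a * den s) \in spec_pred P by rewrite uas idealMr.
  by rewrite !prime_idealrM !(negPf (denP _)) orbF.
by exists a, denom1.
Qed.

End Localization.

Section Zariski.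
Context {A : comNzRingType}.

HB.instance Definition _ := gen_eqMixin (Spec A).
HB.instance Definition _ := gen_choiceMixin (Spec A).

Definition zeros (E : set A) : set (Spec A) := [set P | forall f, E f -> f \in spec_pred P].

Definition zariski_open (U : set (Spec A)) : Prop := exists E, U = ~` zeros E.

Fact zariski_openT : zariski_open setT.
Proof.
exists setT; rewrite -setC0; congr (~` _); apply/seteqP; split=> // P /(_ 1 I).
by rewrite idealr1.
Qed.

Fact zariski_openI : setI_closed zariski_open.
Proof.
move=> _ _ [E ->] [F ->]; exists [set f | exists a b, [/\ E a, F b & f = a * b]].
rewrite -setCU; congr (~` _); apply/seteqP; split=> P /=.
  case=> h _ [a [b [Ea Fb ->]]]; rewrite prime_idealrM.
    by rewrite (h a Ea).
  by rewrite (h b Fb) orbT.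
move=> h; apply: contrapT => /not_orP[] /existsNP[a /not_implyP[Ea aP]].
move=> /existsNP[b /not_implyP[Fb bP]].
have : a * b \in spec_pred P by apply: h; exists a, b.
by rewrite prime_idealrM => /orP[].
Qed.

Fact zariski_open_bigU (I : Type) (f : I -> set (Spec A)) :
  (forall i, zariski_open (f i)) -> zariski_open (\bigcup_i f i).
Proof.
move=> /choice[E fE]; exists (\bigcup_i E i); rewrite -[LHS]setCK; congr (~` _).
rewrite setC_bigcup; apply/seteqP; split=> P /= h.
  by move=> a [i _ Ea]; have := h i Logic.I; rewrite fE setCK; apply.
by move=> i _; rewrite fE setCK => a Ea; apply: h; exists i.
Qed.

HB.instance Definition _ := isOpenTopological.Build (Spec A)
  zariski_openT zariski_openI zariski_open_bigU.

End Zariski.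

Section Ideals.
Context {R : comNzRingType}.
Implicit Types (I E : set R).

Definition is_ideal I : Prop :=
  [/\ I 0, forall a b, I a -> I b -> I (a + b) & forall a b, I b -> I (a * b)].

Definition ideal_gen E : set R := [set a | a \in span (E : set R^o)].

Fixpoint ideal_pow I (m : nat) : set R :=
  if m is m'.+1 then ideal_gen [set a * b | a in I & b in ideal_pow I m']
  else setT.

(* Generators of the submodule I M of M. *)
Definition ideal_smul I (M : lmodType R) : set M :=
  [set a *: v | a in I & v in setT].

Definition noetherian : Prop :=
  forall I, is_ideal I -> exists s : seq R, I = ideal_gen [set a | a \in s].

Lemma ideal_genP E : is_ideal (ideal_gen E).
Proof.
split=> [|a b|a b]; rewrite /ideal_gen /=; first exact: rpred0.
- exact: rpredD.
- exact: (@rpredZ _ R^o).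
Qed.

Lemma ideal_powP I m : is_ideal (ideal_pow I m).
Proof. by case: m => [|m]; [split | exact: ideal_genP]. Qed.

Lemma ideal_powS I m : ideal_pow I m.+1 `<=` ideal_pow I m.
Proof.
have [J0 JD JM] := ideal_powP I m => x.
by apply: (@sub_span _ R^o) => // _ [a _ [b Jb <-]]; exact: JM.
Qed.

End Ideals.
Arguments noetherian R : clear implicits.
Arguments ideal_smul {R} I M.

Definition fps (n : nat) (A : comNzRingType) : Type := 'X_{1..n} -> A.

Section PowerSeries.
Context {n : nat} {A : comNzRingType}.
Implicit Types (f g h : fps n A) (m : 'X_{1..n}).

HB.instance Definition _ := gen_eqMixin (fps n A).
HB.instance Definition _ := gen_choiceMixin (fps n A).

Lemma fpsP f g : (forall m, f m = g m) -> f = g.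
Proof. exact: functional_extensionality_dep. Qed.

Definition fps_of_poly (p : {mpoly A[n]}) : fps n A := fun m => p@_m.

Definition fps_opp f : fps n A := fun m => - f m.
Definition fps_add f g : fps n A := fun m => f m + g m.
Definition fps_mul f g : fps n A := fun m =>
  \sum_(k : 'X_{1..n < (mdeg m).+1, (mdeg m).+1} | m == (k.1 + k.2)%MM)
    f k.1 * g k.2.

Fact fps_addA : associative fps_add.
Proof. by move=> f g h; apply: fpsP => m; rewrite /fps_add addrA. Qed.
Fact fps_addC : commutative fps_add.
Proof. by move=> f g; apply: fpsP => m; rewrite /fps_add addrC. Qed.
Fact fps_add0 : left_id (fps_of_poly 0) fps_add.
Proof. by move=> f; apply: fpsP => m; rewrite /fps_add /fps_of_poly mcoeff0 add0r. Qed.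
Fact fps_addN : left_inverse (fps_of_poly 0) fps_opp fps_add.
Proof.
by move=> f; apply: fpsP => m; rewrite /fps_add /fps_opp /fps_of_poly mcoeff0 addNr.
Qed.
HB.instance Definition _ := GRing.isZmodule.Build (fps n A)
  fps_addA fps_addC fps_add0 fps_addN.

Definition fps_trunc (d : nat) f : {mpoly A[n]} :=
  \sum_(m : 'X_{1..n < d}) f m *: 'X_[m].

Lemma fps_truncE d f m : (mdeg m < d)%N -> (fps_trunc d f)@_m = f m.
Proof. exact: mcoeff_mpoly. Qed.

Lemma fps_mulE f g m (p q : {mpoly A[n]}) :
  (forall k, (mdeg k <= mdeg m)%N -> p@_k = f k) ->
  (forall k, (mdeg k <= mdeg m)%N -> q@_k = g k) ->
  fps_mul f g m = (p * q)@_m.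
Proof.
move=> pf qg; rewrite mcoeffM; apply: eq_bigr => k _.
by rewrite pf ?qg // -ltnS bmdeg.
Qed.

Lemma fps_mul_trunc f g d m : (mdeg m < d)%N ->
  fps_mul f g m = (fps_trunc d f * fps_trunc d g)@_m.
Proof.
by move=> md; apply: fps_mulE => k km; apply: fps_truncE; exact: leq_ltn_trans md.
Qed.

Fact fps_mulA : associative fps_mul.
Proof.
move=> f g h; apply: fpsP => m; pose T := fps_trunc (mdeg m).+1.
rewrite (@fps_mulE _ _ _ (T f) (T g * T h)); last 2 first.
- by move=> k km; exact: fps_truncE.
- by move=> k km; rewrite -fps_mul_trunc.
rewrite mulrA; apply/esym/fps_mulE => k km; last exact: fps_truncE.
by rewrite -fps_mul_trunc.
Qed.
Fact fps_mulC : commutative fps_mul.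
Proof.
move=> f g; apply: fpsP => m.
by rewrite !(fps_mul_trunc _ _ (ltnSn (mdeg m))) mulrC.
Qed.
Fact fps_mul1 : left_id (fps_of_poly 1) fps_mul.
Proof.
move=> f; apply: fpsP => m.
rewrite (@fps_mulE _ _ _ 1 (fps_trunc (mdeg m).+1 f)) // ?mul1r ?fps_truncE //.
by move=> k km; exact: fps_truncE.
Qed.
Fact fps_mulDl : left_distributive fps_mul fps_add.
Proof.
move=> f g h; apply: fpsP => m; rewrite /fps_add /fps_mul -big_split /=.
by apply: eq_bigr => k _; rewrite mulrDl.
Qed.
Fact fps_1neq0 : fps_of_poly 1 != 0.
Proof.
apply/eqP => h; have /eqP : fps_of_poly 1 0%MM = fps_of_poly 0 0%MM by rewrite h.
by rewrite /fps_of_poly mcoeff1 mcoeff0 eqxx oner_eq0.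
Qed.
HB.instance Definition _ := GRing.Zmodule_isComNzRing.Build (fps n A)
  fps_mulA fps_mulC fps_mul1 fps_mulDl fps_1neq0.

Fact fps_of_poly_zmod_morphism : zmod_morphism fps_of_poly.
Proof. by move=> p q; apply: fpsP => m; rewrite /fps_of_poly mcoeffB. Qed.
Fact fps_of_poly_monoid_morphism : monoid_morphism fps_of_poly.
Proof. by split=> // p q; apply: fpsP => m; apply/esym/fps_mulE. Qed.
HB.instance Definition _ := GRing.isZmodMorphism.Build {mpoly A[n]} (fps n A)
  fps_of_poly fps_of_poly_zmod_morphism.
HB.instance Definition _ := GRing.isMonoidMorphism.Build {mpoly A[n]} (fps n A)
  fps_of_poly fps_of_poly_monoid_morphism.

Definition fps_const : A -> fps n A := fps_of_poly \o @mpolyC n A.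
HB.instance Definition _ := GRing.RMorphism.on fps_const.

Definition fps_xideal : set (fps n A) := ideal_gen (range (fun i => fps_of_poly 'X_i)).

End PowerSeries.

Section CompletedFibre.
Context {n : nat} {A : comNzRingType} (M : lmodType (fps n A)).

(* M / <x>^m M *)
Definition jet (m : nat) : Type := quotmod (ideal_smul (ideal_pow fps_xideal m) M).
HB.instance Definition _ m := GRing.Lmodule.on (jet m).

Fact jet_proj_subproof m v : ideal_smul (ideal_pow fps_xideal m.+1) M v ->
  qproj (ideal_smul (ideal_pow fps_xideal m) M) v = 0.
Proof.
case=> a Ia [w _ <-]; rewrite -(linear0 (qproj (ideal_smul _ M))).
apply/qprojP; rewrite subr0; apply: mem_span.
by exists a; [exact: ideal_powS | exists w].
Qed.

Definition jet_proj m : jet m.+1 -> jet m := qlift _ (@jet_proj_subproof m).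
Arguments jet_proj : clear implicits.
HB.instance Definition _ m := GRing.Linear.on (jet_proj m).

Context (P : Spec A).

Definition jet_fibre (m : nat) : lmodType (residue_field P) :=
  tensor (to_residue P) (restr (@fps_const n A) (jet m)).

Definition jet_fibre_proj m : {linear jet_fibre m.+1 -> jet_fibre m} :=
  @tensor_map _ _ (to_residue P) (restr (@fps_const n A) (jet m.+1))
    (restr (@fps_const n A) (jet m)) (restr_map fps_const (jet_proj m)).

Definition completed_fibre : lmodType (residue_field P) := invlim jet_fibre_proj.

Definition fibre_dim : \bar int := vdim completed_fibre.

End CompletedFibre.

Section Etale.
Context {A B : comNzRingType} (phi : {rmorphism A -> B}).

Definition finitely_presented : Prop :=
  exists k (s : seq {mpoly A[k]}) (e : {rmorphism {mpoly A[k]} -> B}),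
    [/\ forall a, e a%:MP = phi a,
        forall b, exists f, e f = b &
        forall f, e f = 0 <-> ideal_gen [set g | g \in s] f].

(* A surjection pi with square-zero kernel stands for the quotient map of C by a
   square-zero ideal. *)
Definition formally_etale : Prop :=
  forall (C D : comPzRingType) (pi : {rmorphism C -> D}),
    (forall d, exists c, pi c = d) ->
    (forall c c', pi c = 0 -> pi c' = 0 -> c * c' = 0) ->
  forall (u : {rmorphism A -> C}) (v : {rmorphism B -> D}),
    (forall a, v (phi a) = pi (u a)) ->
  exists l : {rmorphism B -> C},
    [/\ forall a, l (phi a) = u a,
        forall b, pi (l b) = v b &
        forall l' : {rmorphism B -> C}, (forall a, l' (phi a) = u a) ->
          (forall b, pi (l' b) = v b) -> forall b, l' b = l b].

Definition etale : Prop := finitely_presented /\ formally_etale.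

End Etale.

Section AlgebraicPowerSeries.
Context {n : nat} {A : comNzRingType}.

(* The map A[x]/<x> -> B/<x>B induced by phi is injective and surjective. *)
Definition iso_mod_x (B : comNzRingType) (phi : {rmorphism {mpoly A[n]} -> B}) : Prop :=
  let IA := ideal_gen (range (fun i => 'X_i : {mpoly A[n]})) in
  let IB := ideal_gen (range (fun i => phi 'X_i)) in
  (forall p, IB (phi p) -> IA p) /\ (forall b, exists p, IB (b - phi p)).

(* The image in A[[x]] of the colimit of the etale A[x]-algebras B that are
   isomorphisms modulo <x>.  For such a B there is exactly one homomorphism psi
   of A[x]-algebras from B to A[[x]]: A[[x]] is <x>-adically complete, so by formal
   etaleness psi is determined by its reduction modulo <x>, which kills the x_i
   and hence is the given isomorphism of B/<x>B with A.  These psi are the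
   components of the canonical map from the Henselization to the completion. *)
Definition algebraic_series : set (fps n A) := [set f |
  exists (B : comNzRingType) (phi : {rmorphism {mpoly A[n]} -> B}),
    [/\ etale phi, iso_mod_x phi &
        exists (psi : {rmorphism B -> fps n A}) (b : B),
          (forall p, psi (phi p) = fps_of_poly p) /\ f = psi b]].

Lemma etale_id : etale (idfun : {rmorphism A -> A}).
Proof.
split; last first.
  move=> C D pi _ _ u v uv; exists u; split=> // b.
    by rewrite -uv.
exists 0%N, [::], (meval (fun=> 0) : {rmorphism {mpoly A[0]} -> A}); split.
- by move=> a; rewrite /= mevalC.
- by move=> b; exists b%:MP; rewrite /= mevalC.
- move=> f; split=> [|fs]; last first.
    have -> : f = 0; last by rewrite raddf0.
    apply: (@sub_span _ {mpoly A[0]}^o _ (fun f => f = 0)) fs => // [g h|c g].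
      by move=> -> ->; rewrite addr0.
    by move=> ->; rewrite scaler0.
  have fE : f = (f@_0)%:MP.
    apply/mpolyP => m; rewrite mcoeffC; have -> : m = 0%MM by apply/mnmP => -[].
    by rewrite eqxx mulr1.
  rewrite fE /= mevalC => ->; rewrite mpolyC0.
  by have [] := ideal_genP [set g : {mpoly A[0]} | g \in [::]].
Qed.

End AlgebraicPowerSeries.

Lemma algebraic_poly (n : nat) (A : comNzRingType) (p : {mpoly A[n]}) :
  algebraic_series (fps_of_poly p).
Proof.
exists {mpoly A[n]}, idfun; split; first exact: etale_id.
  split=> // b; exists b; rewrite /= subrr.
  by have [] := ideal_genP (range (fun i => 'X_i : {mpoly A[n]})).
by exists fps_of_poly, p.
Qed.

(* Main.v *)
(* Let F_m = (M / <x>^m M) (x) k(Q) be the fibres of the jets.  The transition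
   maps F_{m+1} -> F_m are surjective, and as soon as one of them is injective,
   <x>^m kills the fibre modulo <x>^{m+1}, so all the later ones are injective and
   the completed fibre is F_m.  Let d be the dimension of the completed fibre at P.
   The jet module M / <x>^{d+1} M is finitely generated over A, so its fibres have
   dimension at most d for Q near P.  There the d + 1 surjections from F_{d+1} down
   to F_0 cannot all drop the dimension, so the completed fibre at Q is some F_j
   with j <= d, a quotient of F_{d+1}. *)
From HB Require Import structures.
Require Import Defs.
From mathcomp Require Import all_boot all_order all_algebra.
From mathcomp Require Import generic_quotient ring.
From mathcomp.multinomials Require Import mpoly.
From mathcomp Require Import boolp.
From mathcomp Require Import classical_sets constructive_ereal topology_structure.

Set Implicit Arguments.
Unset Strict Implicit.
Unset Printing Implicit Defensive.

Import Order.TTheory GRing.Theory Num.Theory.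
Local Open Scope classical_set_scope.
Local Open Scope ring_scope.

(** * Finite spanning families in modules *)

Section LinearCombinations.
Context {R : pzRingType} {V : lmodType R}.

Definition spans (I : finType) (w : I -> V) : Prop :=
  forall v, exists c : I -> R, v = \sum_i c i *: w i.

Section Combination.
Context (I : finType) (w : I -> V).

Definition comb v : Prop := exists c : I -> R, v = \sum_i c i *: w i.

Lemma comb0 : comb 0.
Proof. by exists (fun=> 0); rewrite big1 // => i _; rewrite scale0r. Qed.

Lemma combD u v : comb u -> comb v -> comb (u + v).
Proof.
move=> [c ->] [d ->]; exists (fun i => c i + d i).
by rewrite -big_split; apply: eq_bigr => i _; rewrite scalerDl.
Qed.

Lemma combZ a v : comb v -> comb (a *: v).
Proof.
move=> [c ->]; exists (fun i => a * c i).
by rewrite scaler_sumr; apply: eq_bigr => i _; rewrite scalerA.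
Qed.

Lemma comb_sum (J : finType) (u : J -> V) : (forall j, comb (u j)) -> comb (\sum_j u j).
Proof.
by move=> h; elim/big_ind: _ => // *; [exact: comb0 | exact: combD].
Qed.

Lemma comb_gen i : comb (w i).
Proof.
exists (fun j => (j == i)%:R).
rewrite (bigD1 i) //= eqxx scale1r big1 ?addr0 // => j /negPf ->.
by rewrite scale0r.
Qed.
End Combination.

Lemma spans_ord (I : finType) (w : I -> V) : spans w ->
  exists r (w' : 'I_r -> V), spans w'.
Proof.
move=> h; exists #|I|, (w \o enum_val) => v; have [c ->] := h v.
exists (c \o enum_val); rewrite -[RHS](big_enum_val (fun i => c i *: w i)).
exact: eq_bigl.
Qed.

End LinearCombinations.

Lemma spans_surj (R : pzRingType) (V W : lmodType R) (f : {linear V -> W})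
    (I : finType) (w : I -> V) :
  (forall y, exists x, f x = y) -> spans w -> spans (f \o w).
Proof.
move=> fs h y; have [x <-] := fs y; have [c ->] := h x; exists c.
by rewrite linear_sum; apply: eq_bigr => i _; rewrite linearZ.
Qed.

(** * Independent families and dimension over a field *)

Section Dimension.
Context {K : fieldType}.
Implicit Types V W : lmodType K.

Definition free_family V d (e : 'I_d -> V) : Prop :=
  forall c : 'I_d -> K, \sum_i c i *: e i = 0 -> forall i, c i = 0.

(** Expanding the [u i] in [w] gives an e by d matrix [B]. If d < e, its left kernel is nonzero, and
    a nonzero row of that kernel is a linear dependence among the [u i]. *)
Lemma free_le_span V d e (w : 'I_d -> V) (u : 'I_e -> V) :
  spans w -> free_family u -> (e <= d)%N.
Proof.
move=> ws uf; have [C uE] := choice (fun i => ws (u i)).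
rewrite leqNgt; apply/negP => de; pose B := \matrix_(i, j) C i j.
have kB : kermx B != 0.
  by rewrite -mxrank_eq0 mxrank_ker subn_eq0 -ltnNge (leq_ltn_trans (rank_leq_col B)).
have [i ri] : exists i, row i (kermx B) != 0.
  by apply/existsP; apply: contraNT kB => /existsPn h;
    apply/eqP/row_matrixP => i; rewrite row0; apply/eqP; have := h i; rewrite negbK.
have rB : row i (kermx B) *m B = 0 by rewrite -row_mul mulmx_ker row0.
move/eqP: ri; apply; apply/rowP => j; rewrite [RHS]mxE.
apply: (uf (fun j => row i (kermx B) 0 j)) j.
under eq_bigr => j _ do rewrite uE scaler_sumr.
rewrite exchange_big big1 //= => k _.
under eq_bigr => j _ do rewrite scalerA.
rewrite -scaler_suml.
have -> : \sum_j row i (kermx B) 0 j * C j k = (row i (kermx B) *m B) 0 k.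
  by rewrite [RHS]mxE; apply: eq_bigr => j _; rewrite [B _ _]mxE.
by rewrite rB mxE scale0r.
Qed.

(** Adjoin [x] to lifts of the [u i]. Applying [f] to a relation kills the term in [x], so the
    coefficients of the lifts vanish; then [x != 0] forces the last one to vanish. *)
Lemma free_extend V W (f : {linear V -> W}) (x : V) d (u : 'I_d -> W) :
    (forall y, exists v, f v = y) -> x != 0 -> f x = 0 -> free_family u ->
  exists u' : 'I_d.+1 -> V, free_family u'.
Proof.
move=> fs x0 fx uf; have [v fv] := choice (fun i => fs (u i)).
exists (fun i => if unlift ord0 i is Some j then v j else x) => c.
rewrite big_ord_recl unlift_none; under eq_bigr => i _ do rewrite liftK.
move=> cE; have cl i : c (lift ord0 i) = 0.
  apply: (uf (fun i => c (lift ord0 i))).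
  transitivity (f 0); last exact: linear0.
  rewrite -cE linearD linearZ /= fx scaler0 add0r linear_sum.
  by apply: eq_bigr => j _; rewrite linearZ /= fv.
move: cE; rewrite big1 ?addr0 => [/eqP|i _]; last by rewrite cl scale0r.
rewrite scaler_eq0 (negPf x0) orbF => /eqP c0 i.
by case: (unliftP ord0 i) => [j|] ->.
Qed.

Lemma free_add V d (u : 'I_d -> V) x :
    free_family u -> ~ comb u x -> exists u' : 'I_d.+1 -> V, free_family u'.
Proof.
move=> uf xu; exists (fun i => if unlift ord0 i is Some j then u j else x) => c.
rewrite big_ord_recl unlift_none; under eq_bigr => i _ do rewrite liftK.
move=> cE; have c0 : c ord0 = 0.
  apply: contra_notP xu => /eqP c0; exists (fun i => - (c ord0)^-1 * c (lift ord0 i)).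
  under eq_bigr do rewrite -scalerA.
  rewrite -scaler_sumr scaleNr -scalerN.
  move/eqP: cE; rewrite addr_eq0 => /eqP <-.
  by rewrite scalerA mulVf // scale1r.
move: cE; rewrite c0 scale0r add0r => /uf cl i.
by case: (unliftP ord0 i) => [j|] ->.
Qed.

(** Free families have bounded length, so there is a longest one, and [free_add] makes it a
    basis. *)
Lemma vdim_le V (d : nat) :
    (forall e (u : 'I_e -> V), free_family u -> (e <= d)%N) ->
  (vdim V <= d%:Z%:E)%E.
Proof.
move=> hd; pose F e := `[< exists u : 'I_e -> V, free_family u >].
have F0 : exists e, F e by exists 0%N; apply/asboolP; exists (fun=> 0) => c _ [].
have Fd e : F e -> (e <= d)%N by move=> /asboolP[u /hd].
have [e /asboolP[u uf] eM] := ex_maxnP F0 Fd.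
have ub : is_basis u.
  split=> // v; apply: contrapT => /(free_add uf) h.
  by have /eM := asboolT h; rewrite ltnn.
(* The basis selected by [vdim] may differ from [u], but it is free and so obeys the same bound; the
   default value +oo is excluded because [u] exists. *)
rewrite /vdim; case: xgetP => [_ -> [e' [u' [/hd e'd _]] <-]|/(_ e%:Z%:E)[]].
  by rewrite lee_fin lez_nat.
by exists e => //; exists u.
Qed.

Lemma vdim_fin V : (vdim V < +oo)%E ->
  exists d (u : 'I_d -> V), vdim V = d%:Z%:E /\ spans u.
Proof.
rewrite /vdim; case: xgetP => [_ -> [d [u [_ us]] <-] _|_]; last by rewrite ltxx.
by exists d, u.
Qed.

End Dimension.

(** * Residue field elements as fractions *)

Section ResidueFraction.
Context {A : comNzRingType} (P : Spec A).
Local Notation res := (to_residue P).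

Lemma residue_frac (k : residue_field P) :
  exists s a, res s != 0 /\ res s * k = res a.
Proof.
have -> : k = rproj (repr k) by rewrite /rproj reprK.
move: (repr k); apply: lfrac_ind => a s; exists (den s), a; split.
  by rewrite to_residue_eq0 denP.
rewrite /to_residue /= -rmorphM /to_loc; congr rproj.
rewrite -[LHS]/(loc_mul _ _) lfracM; apply: lfrac_eq.
by rewrite /= ?denomE !mul1r mulr1 mulrC.
Qed.

End ResidueFraction.

(** * Base change: generators, surjections and kernels *)

Section TensorRing.
Context {A K : comNzRingType} (g : {rmorphism A -> K}) (N : lmodType A).

Lemma tens0l k : tens g (0 : N) k = 0.
Proof. by apply: (addrI (tens g (0 : N) k)); rewrite -tensDl !addr0. Qed.

Lemma tens_suml (I : finType) (F : I -> N) k :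
  tens g (\sum_i F i) k = \sum_i tens g (F i) k.
Proof. by apply: (big_morph (fun n => tens g n k)) => [u v|]; rewrite ?tensDl ?tens0l. Qed.

Lemma tensZl a (n : N) k : tens g (a *: n) k = g a *: tens g n k.
Proof. by rewrite tens_bal tensZ. Qed.

Lemma tensE (n : N) k : tens g n k = k *: tens g n 1.
Proof. by rewrite -tensZ mulr1. Qed.

Lemma tens_spans (I : finType) (v : I -> N) (J : finType) (w : J -> tensor g N) :
  spans v -> (forall i, comb w (tens g (v i) 1)) -> spans w.
Proof.
move=> vs h; apply: tensor_ind => [|x y|n k]; [exact: comb0 | exact: combD |].
rewrite tensE; apply: combZ; have [a ->] := vs n; rewrite tens_suml.
by apply: comb_sum => i; rewrite tensZl; apply: combZ.
Qed.

Context {N' : lmodType A} (h : {linear N -> N'}).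
Hypothesis h_surj : forall y, exists x, h x = y.

Lemma tensor_map_surj y : exists x, tensor_map g h x = y.
Proof.
move: y; apply: tensor_ind => [|_ _ [x <-] [y <-]|n k].
- by exists 0; rewrite linear0.
- by exists (x + y); rewrite linearD.
by have [x <-] := h_surj n; exists (tens g x k); rewrite tensor_mapE.
Qed.

(* Right exactness: lifting along [h] is then well defined modulo [ker h], which
   gives a retraction of [tensor_map g h]. *)
Lemma tensor_map_inj :
  (forall n, h n = 0 -> tens g n 1 = 0) -> injective (tensor_map g h).
Proof.
move=> h0; have [s hs] := choice h_surj.
have tE n n' k : h n = h n' -> tens g n k = tens g n' k.
  move=> nn'; rewrite -[n](subrK n') tensDl [X in X + _]tensE h0 ?scaler0 ?add0r //.
  by rewrite linearB /= nn' subrr.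
pose b (n : N') k := tens g (s n) k.
have b1 k : {morph b^~ k : n n' / n + n'}.
  by move=> n n'; rewrite /b -tensDl; apply: tE; rewrite linearD !hs.
have b2 n : {morph b n : k k' / k + k'} by move=> k k'; exact: tensDr.
have b3 a n k : b (a *: n) k = b n (g a * k).
  by rewrite /b -tens_bal; apply: tE; rewrite linearZ /= !hs.
have b4 c n k : b n (c * k) = c *: b n k by exact: tensZ.
apply: (can_inj (g := tensor_lift b1 b2 b3 b4)) => x; move: x.
apply: tensor_ind => [|x y xE yE|n k].
- by rewrite !linear0.
- by rewrite !linearD /= xE yE.
- by rewrite tensor_mapE tensor_liftE; apply: tE; rewrite hs.
Qed.
End TensorRing.

(** * Semicontinuity for the fibres of a finitely generated module *)

Section FibreSemicontinuity.
Context {A : comNzRingType} (N : lmodType A).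

Section AtPoint.
Context {K : fieldType} (res : {rmorphism A -> K}).
(** The property of residue fields that allows denominators to be cleared; [residue_frac] supplies
    it. *)
Hypothesis res_frac : forall k, exists s a, res s != 0 /\ res s * k = res a.

Lemma res_frac_family (I : finType) (k : I -> K) :
  exists s (a : I -> A), res s != 0 /\ forall i, res s * k i = res (a i).
Proof.
have [s /choice[a h]] := choice (fun i => res_frac (k i)).
exists (\prod_i s i), (fun i => (\prod_(j | j != i) s j) * a i); split.
  by rewrite rmorph_prod; apply/prodf_neq0 => i _; have [] := h i.
move=> i; rewrite (bigD1 i) //= [s i * _]mulrC !rmorphM -mulrA.
by have [_ ->] := h i.
Qed.

Lemma tensor_frac (x : tensor res N) :
  exists s n, res s != 0 /\ res s *: x = tens res n 1.
Proof.
move: x; apply: tensor_ind => [|x y [s [n [s0 sE]]] [t [m [t0 tE]]]|n k].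
- by exists 1, 0; rewrite rmorph1 oner_eq0 scaler0 tens0l.
- exists (s * t), (t *: n + s *: m); split.
    by rewrite rmorphM mulf_neq0.
  rewrite tensDl (tensZl _ t) (tensZl _ s).
  rewrite -sE -tE scalerDr (scalerA (res t)) (scalerA (res s)) (mulrC (res t)).
  by rewrite rmorphM.
- have [s [a [s0 sk]]] := res_frac k; exists s, (a *: n); split=> //.
  by rewrite -tensZ sk tens_bal mulr1.
Qed.

(** [N] is A^r modulo the relations among the [v i], so its fibre maps to K^r modulo the reduced
    relations. If the tensor of [n] vanishes, the reduced coefficient vector of [n] is a combination
    of reduced relations. Clear denominators and subtract a genuine relation: the remaining
    coefficients [p] reduce to 0. *)
Lemma tens_eq0 r (v : 'I_r -> N) n : spans v -> tens res n 1 = 0 ->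
  exists s (p : 'I_r -> A),
    [/\ res s != 0, forall i, res (p i) = 0 & s *: n = \sum_i p i *: v i].
Proof.
move=> vs n0; have [l lE] := choice vs.
pose S : set 'rV[K]_r := [set z | exists a : 'I_r -> A,
  \sum_i a i *: v i = 0 /\ z = \row_i res (a i)].
pose cls (a : 'I_r -> A) := qproj S (\row_i res (a i)).
(* The chosen coefficients [l] need not be additive in the vector; their class modulo [S] is, which
   makes [b] below bilinear. *)
have clsE (a b : 'I_r -> A) : \sum_i a i *: v i = \sum_i b i *: v i -> cls a = cls b.
  move=> ab; apply/qprojP/mem_span; exists (fun i => a i - b i); split.
    rewrite (eq_bigr (fun i => a i *: v i - b i *: v i)) => [|i _].
      by rewrite sumrB ab subrr.
    by rewrite scalerBl.
  by apply/rowP => i; rewrite !mxE rmorphB.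
pose b m k := k *: cls (l m).
have b1 k : {morph b^~ k : m m' / m + m'}.
  move=> m m'; rewrite /b -scalerDr; congr (_ *: _).
  rewrite -linearD /= (_ : _ + _ = \row_i res (l m i + l m' i)).
    apply: clsE; rewrite -lE [in LHS](lE m) [in LHS](lE m') -big_split.
    by apply: eq_bigr => i _; rewrite scalerDl.
  by apply/rowP => i; rewrite !mxE rmorphD.
have b2 m : {morph b m : k k' / k + k'} by move=> k k'; exact: scalerDl.
have b3 a m k : b (a *: m) k = b m (res a * k).
  rewrite /b mulrC -scalerA; congr (_ *: _); rewrite -linearZ /=.
  rewrite (_ : _ *: _ = \row_i res (a * l m i)).
    apply: clsE; rewrite -lE [in LHS](lE m) scaler_sumr.
    by apply: eq_bigr => i _; rewrite scalerA.
  by apply/rowP => i; rewrite !mxE rmorphM.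
have b4 c m k : b m (c * k) = c *: b m k by rewrite /b scalerA.
have : b n 1 = 0 by rewrite -(tensor_liftE b1 b2 b3 b4) n0 linear0.
rewrite /b scale1r -(linear0 (qproj S)) => /qprojP; rewrite subr0.
(* The vectors that some nonzero [res s] turns into a reduced relation form a subspace containing
   [S]. *)
pose Z (z : 'rV[K]_r) := exists s (a : 'I_r -> A),
  [/\ res s != 0, \sum_i a i *: v i = 0 & forall i, res s * z 0 i = res (a i)].
have ZD y z : Z y -> Z z -> Z (y + z).
  move=> [s [a [s0 a0 sy]]] [t [c [t0 c0 tz]]].
  exists (s * t), (fun i => t * a i + s * c i); split.
  - by rewrite rmorphM mulf_neq0.
  - under eq_bigr do rewrite scalerDl -!scalerA.
    by rewrite big_split /= -!scaler_sumr a0 c0 !scaler0 addr0.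
  - by move=> i; rewrite !mxE rmorphD !rmorphM -sy -tz; ring.
have ZZ (k : K) z : Z z -> Z (k *: z).
  move=> [s [a [s0 a0 sz]]]; have [t [c [t0 tk]]] := res_frac k.
  exists (s * t), (fun i => c * a i); split.
  - by rewrite rmorphM mulf_neq0.
  - under eq_bigr do rewrite -!scalerA.
    by rewrite -!scaler_sumr a0 scaler0.
  - by move=> i; rewrite !mxE !rmorphM -sz -tk; ring.
case/(@Defs.sub_span _ _ S Z).
- exists 1, (fun=> 0); rewrite rmorph1 oner_eq0; split=> // [|i].
    by rewrite big1 // => i _; rewrite scale0r.
  by rewrite mxE mulr0 rmorph0.
- exact: ZD.
- exact: ZZ.
- move=> _ [a [a0 ->]]; exists 1, a; rewrite rmorph1 oner_eq0.
  by split=> // i; rewrite mxE mul1r.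
move=> s [a [s0 a0 sl]]; exists s, (fun i => s * l n i - a i); split=> // [i|].
  by rewrite rmorphB rmorphM -sl mxE subrr.
under eq_bigr do rewrite scalerBl -scalerA.
by rewrite sumrB -scaler_sumr -lE a0 subr0.
Qed.
(* Clearing denominators in the relations that express the generators [v] at the
   point [res] through lifts [n] of [w] gives a square system whose determinant
   [g] does not vanish there; Cramer's rule solves it wherever [g] is nonzero. *)
Lemma fibre_spans_nbhs r (v : 'I_r -> N) d (w : 'I_d -> tensor res N) :
    spans v -> spans w ->
  exists g, res g != 0 /\ forall (L : fieldType) (h : {rmorphism A -> L}),
    h g != 0 -> exists w' : 'I_d -> tensor h N, spans w'.
Proof.
move=> vs ws.
have [s /choice[n sn]] := choice (fun j => tensor_frac (w j)).
have vE i : exists t (b : 'I_d -> A) (p : 'I_r -> A),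
    [/\ res t != 0, forall l, res (p l) = 0 &
        t *: v i = \sum_j b j *: n j + \sum_l p l *: v l].
  have [c cE] := ws (tens res (v i) 1).
  (* The tensor of [n j] is [res (s j) *: w j], so coefficients with respect to [w] are divided by
     [res (s j)]; [t] is a common denominator of the quotients. *)
  have [t [a [t0 ta]]] := res_frac_family (fun j => c j / res (s j)).
  have [|t' [p [t'0 p0 pE]]] := @tens_eq0 r v (t *: v i - \sum_j a j *: n j) vs.
    rewrite -scaleN1r tensDl !tensZl rmorphN1 scaleN1r tens_suml cE scaler_sumr -sumrB.
    rewrite big1 // => j _; have [s0 sw] := sn j.
    by rewrite tensZl -ta -sw !scalerA -mulrA divfK // subrr.
  exists (t' * t), (fun j => t' * a j), p; split=> //.
    by rewrite rmorphM mulf_neq0.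
  rewrite -pE scalerBr !scalerA; under eq_bigr do rewrite -scalerA.
  by rewrite -scaler_sumr addrC subrK.
have [t /choice[b /choice[p tbp]]] := choice vE.
(* The system reads D v = b n. Since all [p i l] reduce to 0, [D] reduces to the diagonal matrix of
   the nonzero [res (t i)]. *)
pose D := diag_mx (\row_i t i) - \matrix_(i, l) p i l.
have DE i : \sum_l D i l *: v l = \sum_j b i j *: n j.
  have [_ _ tE] := tbp i; rewrite -[RHS](addrK (\sum_l p i l *: v l)) -tE.
  under eq_bigr => l _ do rewrite !mxE scalerBl.
  rewrite sumrB; congr (_ - _); rewrite (bigD1 i) //= eqxx big1 ?addr0 // => l.
  by rewrite eq_sym => /negPf ->; rewrite scale0r.
have gv i : \det D *: v i = \sum_j (\sum_k \adj D i k * b k j) *: n j.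
  transitivity (\sum_k \adj D i k *: \sum_l D k l *: v l).
    under eq_bigr do rewrite scaler_sumr.
    rewrite exchange_big /=.
    under eq_bigr => l _ do (under eq_bigr do rewrite scalerA; rewrite -scaler_suml).
    have aD l : \sum_k \adj D i k * D k l = (\det D)%:M i l.
      by rewrite -mul_adj_mx mxE.
    under eq_bigr => l _ do rewrite aD mxE.
    rewrite (bigD1 i) //= eqxx big1 ?addr0 // => l.
    by rewrite eq_sym => /negPf ->; rewrite scale0r.
  under eq_bigr do rewrite DE scaler_sumr.
  rewrite exchange_big; apply: eq_bigr => j _ /=.
  by rewrite scaler_suml; apply: eq_bigr => k _; rewrite scalerA.
exists (\det D); split=> [|L h g0].
  rewrite -det_map_mx.
  have -> : map_mx res D = diag_mx (\row_i res (t i)).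
    apply/matrixP => i l; rewrite !mxE rmorphB rmorphMn.
    by have [_ -> _] := tbp i; rewrite subr0.
  by rewrite det_diag; apply/prodf_neq0 => i _; rewrite mxE; have [] := tbp i.
exists (fun j => tens h (n j) 1).
apply: (tens_spans vs) => i.
rewrite -[tens _ _ _](scalerK g0) -tensZl gv tens_suml; apply/combZ/comb_sum => j.
by rewrite tensZl; apply: combZ; exact: (comb_gen (fun j => tens h (n j) 1)).
Qed.
End AtPoint.
End FibreSemicontinuity.

(** * Inverse limits along surjections *)

Section InverseLimitDimension.
Context {K : fieldType}.

(** Induction on [m] over all systems at once. For [m] = 0, sections of the maps lift [y] upwards
    step by step. Otherwise a thread of the system shifted by one is prolonged down to index 0 by
    [t 0]. *)
Lemma invlim_val_surj m (F : nat -> lmodType K) (t : forall m, {linear F m.+1 -> F m}) :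
    (forall m y, exists x, t m x = y) ->
  forall y : F m, exists x : invlim t, invlim_val x m = y.
Proof.
elim: m F t => [|m IH] F t ts y.
  have [s sK] : exists s : forall m, F m -> F m.+1, forall m y, t m (s m y) = y.
    exists (fun m => projT1 (choice (ts m))) => k; exact: projT2 (choice (ts k)).
  pose fix x k : F k := if k is k'.+1 then s k' (x k') else y.
  by exists (@InvLim _ _ t x (fun m => sK m (x m))).
have [x xE] := IH (fun m => F m.+1) (fun m => t m.+1) (fun m => ts m.+1) y.
pose x' k : F k := if k is k'.+1 then invlim_val x k' else t 0%N (invlim_val x 0%N).
have x'P k : t k (x' k.+1) = x' k by case: k => [//|k]; exact: invlim_compat.
by exists (InvLim x'P).
Qed.

Context {F : nat -> lmodType K} (t : forall m, {linear F m.+1 -> F m}).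
Hypothesis t_surj : forall m y, exists x, t m x = y.

Definition invlim_ev j (x : invlim t) : F j := invlim_val x j.
Fact invlim_ev_linear j : linear (invlim_ev j). Proof. by []. Qed.
HB.instance Definition _ j := GRing.isLinear.Build K (invlim t) (F j) *:%R
  (invlim_ev j) (invlim_ev_linear j).

Lemma spans_below d m j : (j <= m)%N ->
  (exists w : 'I_d -> F m, spans w) -> exists w : 'I_d -> F j, spans w.
Proof.
move=> /subnK <-; elim: (m - j)%N => [//|k IH] [w ws]; apply: IH.
by exists (t (k + j)%N \o w); exact: spans_surj.
Qed.

Hypothesis t_inj : forall m, injective (t m) -> injective (t m.+1).

Lemma invlim_ev_inj j : injective (t j) -> injective (invlim_ev j).
Proof.
move=> tj x y xy; apply: invlim_eq => m; have tm k : injective (t (k + j)%N).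
  by elim: k => [//|k]; exact: t_inj.
have up k : invlim_val x (k + j)%N = invlim_val y (k + j)%N.
  by elim: k => [//|k IH]; apply: tm; rewrite !invlim_compat.
(* Index [j + m] lies above both [j] and [m]: injectivity carries the equality up from [j], and
   compatibility brings it down to [m]. *)
have: invlim_val x (j + m)%N = invlim_val y (j + m)%N by rewrite addnC up.
elim: j {tj xy tm up} => [//|k IH] h; apply: IH.
rewrite -(invlim_compat x (k + m)%N) -(invlim_compat y (k + m)%N).
exact: (congr1 (t (k + m)%N) h).
Qed.

(* The dimensions of the [F m] cannot increase strictly at each of the d + 1
   steps from [F 0] to [F d.+1], and the first isomorphism forces all later ones. *)
Lemma vdim_invlim_le d (w : 'I_d -> F d.+1) : spans w ->
  (vdim (invlim t) <= d%:Z%:E)%E.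
Proof.
move=> ws; have [j jd tj] : exists2 j, (j <= d)%N & injective (t j).
  apply: contrapT => h.
  have ninj j : (j <= d)%N -> exists2 x, x != 0 & t j x = 0.
    move=> jd; apply: contrapT => hx; apply: h; exists j => // x y xy.
    apply/eqP; rewrite -subr_eq0; apply: contra_notT hx => xy0.
    by exists (x - y); rewrite // linearB /= xy subrr.
  (* If no map up to index [d] were injective, induction on j would give j independent vectors in
     [F j], each kernel adding one; at j = d + 1 this exceeds the spanning family [w]. *)
  have [u /(free_le_span ws)] : exists u : 'I_d.+1 -> F d.+1, free_family u.
    elim: {-2}d.+1 (leqnn d.+1) => [_|j IH jd].
      by exists (fun=> 0) => c _ [].
    have [x x0 tx] := ninj j jd; have [u uf] := IH (ltnW jd).
    exact: (free_extend (t_surj (m := j)) x0 tx uf).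
  by rewrite ltnn.
have [v vs] := spans_below (leqW jd) (ex_intro _ w ws).
apply: vdim_le => e u uf; apply: (free_le_span (w := v) (u := invlim_ev j \o u) vs).
move=> c cE; apply: uf; apply: (invlim_ev_inj tj).
rewrite linear0 linear_sum -[RHS]cE.
by apply: eq_bigr => i _; rewrite linearZ.
Qed.

End InverseLimitDimension.

(** * Splitting power series by the variables *)

Section XAdic.
Context {n : nat} {A : comNzRingType}.
Local Notation R := (fps n A).
Local Notation X i := (fps_of_poly 'X_i : R).
Local Notation I := (@fps_xideal n A).

Lemma fps_mulX i (g : R) m :
  (X i * g) m = if m i == 0%N then 0 else g (m - U_(i))%MM.
Proof.
have [mi|mi] := ifPn.
  rewrite -[LHS]/(fps_mul _ _ _) /fps_mul big1 // => -[k1 k2] /= /eqP mk.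
  rewrite /fps_of_poly mcoeffX; case: eqP => [k1E|_]; last by rewrite mul0r.
  move: mi; rewrite (congr1 (fun m : 'X_{1..n} => m i) mk) /= mnmDE -k1E.
  by rewrite mnm1E eqxx.
rewrite -[LHS]/(fps_mul _ _ _).
rewrite (@fps_mulE _ _ _ _ _ 'X_i (fps_trunc (mdeg m).+1 g)) // => [|k km].
  have mE : (m - U_(i) + U_(i))%MM = m by rewrite submK // lep1mP.
  rewrite mulrC -{1}mE addmC mcoeffMX fps_truncE //.
  by rewrite ltnS mdegB.
by rewrite fps_truncE.
Qed.

Lemma fps_split (f : R) : exists g : 'I_n -> R,
  f = fps_const (f 0%MM) + \sum_i X i * g i.
Proof.
(* A nonconstant monomial is charged to the first variable that it contains. *)
pose first (i : 'I_n) (m : 'X_{1..n}) := [forall j : 'I_n, (j < i)%N ==> (m j == 0%N)].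
exists (fun i m => if first i m then f (m + U_(i))%MM else 0).
apply: fpsP => m; pose ev (h : R) := h m.
have evD : {morph ev : a b / a + b} by [].
rewrite -[RHS]/(ev _) evD (big_morph ev evD (mcoeff0 _ _)) /ev.
under eq_bigr do rewrite fps_mulX.
rewrite /fps_const /= /fps_of_poly mcoeffC; have [->|m0] := eqVneq m 0%MM.
  by rewrite mulr1 big1 ?addr0 // => i _; rewrite mnm0E eqxx.
rewrite mulr0 add0r.
have [i mi] : exists i, m i != 0%N.
  apply/existsP; apply: contraNT m0 => /existsPn h; apply/eqP/mnmP => i.
  by rewrite mnm0E; apply/eqP; have := h i; rewrite negbK.
(* With [i] the first variable occurring in [m], only the summand of [i] contributes to the
   coefficient at [m]. *)
case: (@arg_minnP _ i (fun i => m i != 0%N) val mi) => {mi}i mi imin.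
have m_lt (j : 'I_n) : (j < i)%N -> m j = 0%N.
  by move=> ji; apply/eqP; apply: contraTT ji => /imin; rewrite -leqNgt.
rewrite (bigD1 i) //= (negPf mi) big1 ?addr0 => [|j ji].
  have -> : first i (m - U_(i))%MM.
    by apply/forallP => j; apply/implyP => /m_lt mj; rewrite mnmBE mj.
  by rewrite submK // lep1mP.
case: ifPn => // mj; case: ifP => // /forallP/(_ i); rewrite mnmBE mnm1E (negPf ji) subn0.
rewrite (negPf mi) implybF -leqNgt => le_ji.
by move/negP: ji; case; apply/eqP/val_inj/anti_leq; rewrite le_ji imin.
Qed.

(** * Jets of a module and the maps between their fibres *)

Section Jets.
Context (M : lmodType R).
Local Notation IM m := (ideal_smul (ideal_pow I m) M).

Lemma smul_xideal m a e : I a -> e \in Defs.span (IM m) ->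
  a *: e \in Defs.span (IM m.+1).
Proof.
move=> Ia; apply: (@Defs.sub_span _ _ (IM m) (fun e => a *: e \in Defs.span (IM m.+1))).
- by rewrite scaler0 rpred0.
- by move=> u v; rewrite scalerDr; exact: rpredD.
- by move=> c v; rewrite scalerA mulrC -scalerA; exact: rpredZ.
move=> _ [b Ib [v _ <-]]; rewrite scalerA; apply: mem_span; exists (a * b); last by exists v.
by apply/mem_span; exists a => //; exists b.
Qed.

(** Splitting off constant terms writes an element as an A-combination of the [w j] plus a sum of
    x_i times elements of [M]. The latter are expanded by induction modulo <x>^m, and the factor x_i
    gains one power. *)
Lemma jet_generators q (w : 'I_q -> M) m : spans w ->
  exists (J : finType) (v : J -> M), forall u, exists c : J -> A,
    u - \sum_j fps_const (c j) *: v j \in Defs.span (IM m).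
Proof.
move=> ws; elim: m => [|m [J [v vE]]].
  (* The zeroth power of the ideal is the whole ring, so the empty family suffices. *)
  exists 'I_0, (fun=> 0) => u; exists (fun=> 0); rewrite big_ord0 subr0.
  by apply: mem_span; exists 1 => //; exists u => //; rewrite scale1r.
exists ('I_q + 'I_n * J)%type,
  (fun s => match s with inl j => w j | inr ij => X ij.1 *: v ij.2 end) => u.
have [f ->] := ws u.
have [g gE] := choice (fun j => fps_split (f j)).
have [c cE] := choice (fun i => vE (\sum_j g j i *: w j)).
exists (fun s => match s with inl j => f j 0%MM | inr ij => c ij.1 ij.2 end).
rewrite big_sumType /= -(pair_bigA _ (fun i j => fps_const (c i j) *: (X i *: v j))) /=.
set S := Defs.span _.
have -> : \sum_j f j *: w j
    = \sum_j fps_const (f j 0%MM) *: w j + \sum_i X i *: \sum_j g j i *: w j.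
  under eq_bigr => j _ do rewrite gE scalerDl scaler_suml.
  rewrite big_split /=; congr (_ + _); rewrite exchange_big; apply: eq_bigr => i _.
  by rewrite scaler_sumr; apply: eq_bigr => j _; rewrite scalerA.
rewrite opprD addrACA subrr add0r -sumrB rpred_sum // => i _.
have -> : \sum_j fps_const (c i j) *: (X i *: v j)
    = X i *: \sum_j fps_const (c i j) *: v j.
  by rewrite scaler_sumr; apply: eq_bigr => j _; rewrite !scalerA mulrC.
rewrite -scalerBr; apply: smul_xideal => //.
by apply/mem_span; exists i.
Qed.

Lemma jet_spans q (w : 'I_q -> M) m : spans w ->
  exists r (v : 'I_r -> restr (@fps_const n A) (jet M m)), spans v.
Proof.
move=> /(jet_generators m)[J [v vE]].
apply: (spans_ord (w := fun j => qproj (IM m) (v j) : restr (@fps_const n A) (jet M m))).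
move=> x; have [c /qprojP cE] := vE (repr (x : jet M m)); exists c.
rewrite -[LHS](@qprojK _ _ (IM m)) cE linear_sum.
by apply: eq_bigr => j _; rewrite linearZ.
Qed.

Lemma jet_projE m v : jet_proj (qproj (IM m.+1) v : jet M m.+1) = qproj (IM m) v.
Proof. exact: qliftE. Qed.

Lemma jet_proj_surj m (y : jet M m) : exists x : jet M m.+1, jet_proj x = y.
Proof.
by move: y; apply: qproj_ind => v; exists (qproj _ v); exact: jet_projE.
Qed.

Context {K : comNzRingType} (g : {rmorphism A -> K}).
Local Notation N m := (restr (@fps_const n A) (jet M m)).
Local Notation t m := (@tensor_map _ _ g (N m.+1) (N m)
  (restr_map (@fps_const n A) (@jet_proj n A M m))).
Local Notation cls m u := (qproj (IM m) u : N m).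

(* Multiplication by [a] in <x> maps the [m]-jets to the [m.+1]-jets, so the
   vanishing of <x>^m M in the fibre of the [m.+1]-jets passes to the next step. *)
Lemma jet_fibre_proj_inj m : injective (t m) -> injective (t m.+1).
Proof.
move=> tm; apply: tensor_map_inj => [y|]; first exact: jet_proj_surj.
(* Elements of <x>^m M are zero in the m-jets, so injectivity of the transition map kills them
   already in the fibre of the next jets. *)
have vanish b (v : M) : ideal_pow I m b -> tens g (cls m.+1 (b *: v)) 1 = 0.
  move=> Ib; apply: tm; rewrite linear0 tensor_mapE.
  transitivity (tens g (cls m 0) 1); last by rewrite linear0 tens0l.
  congr (tens g _ _); apply: etrans (jet_projE _ _) _; apply/qprojP.
  by rewrite subr0; apply: mem_span; exists b => //; exists v.
have vanishS a (v : M) : ideal_pow I m.+1 a -> tens g (cls m.+2 (a *: v)) 1 = 0.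
  move=> Ia; apply: (@Defs.sub_span R R^o _
    (fun a => forall v, tens g (cls m.+2 (a *: v)) 1 = 0) _ _ _ _ a Ia v) => {a v Ia}.
  - by move=> v; rewrite scale0r linear0 tens0l.
  - by move=> a b a0 b0 v; rewrite scalerDl linearD tensDl a0 b0 addr0.
  - by move=> c a a0 v; rewrite -scalerA scalerA mulrC -scalerA a0.
  move=> _ [a Ia [b Ib <-]] v.
  have aS s : IM m.+1 s -> (a \*: qproj (IM m.+2))%R s = 0.
    move=> Is; rewrite -[LHS]/(a *: qproj (IM m.+2) s) -linearZ -(linear0 (qproj _)).
    by apply/qprojP; rewrite subr0; exact: smul_xideal Ia (mem_span Is).
  pose mul_a : {linear jet M m.+1 -> jet M m.+2} := qlift _ aS.
  pose h : {linear N m.+1 -> N m.+2} := restr_map (@fps_const n A) mul_a.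
  have hE : h (cls m.+1 (b *: v)) = cls m.+2 ((a * b) *: v).
    apply: etrans (qliftE aS _) _.
    by rewrite -[LHS]/(a *: qproj (IM m.+2) (b *: v)) -linearZ scalerA.
  by rewrite -hE -(tensor_mapE g h) vanish // linear0.
(* A jet that dies in [jet M m.+1] is represented by an element of <x>^(m+1) M. *)
move=> x xE; rewrite -[x](@qprojK _ _ (IM m.+2)).
have : repr (x : jet M m.+2) \in Defs.span (IM m.+1).
  have : qproj (IM m.+1) (repr (x : jet M m.+2)) = qproj (IM m.+1) 0.
    by rewrite linear0 -jet_projE qprojK.
  by move/qprojP; rewrite subr0.
move: (repr _) => u uI; rewrite -[u]scale1r.
(* The fibre is formed over A only, so stability under power series scalars is built into the
   predicate by quantifying over [c]. *)
apply: (@Defs.sub_span R M (IM m.+1)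
  (fun u => forall c, tens g (cls m.+2 (c *: u)) 1 = 0) _ _ _ _ u uI 1) => {x xE u uI}.
- by move=> c; rewrite scaler0 linear0 tens0l.
- by move=> u v u0 v0 c; rewrite scalerDr linearD tensDl u0 v0 addr0.
- by move=> c v v0 d; rewrite scalerA.
by move=> _ [a Ia [v _ <-]] c; rewrite scalerA mulrC -scalerA vanishS.
Qed.
End Jets.
End XAdic.

Theorem theorem42 (A : comNzRingType) (n p q : nat) (M : lmodType (fps n A))
    (T : 'M[fps n A]_(q, p)) (pi : {linear 'cV[fps n A]_q -> M})
    (A_noetherian : noetherian A)
    (pi_surjective : forall v : M, exists w, pi w = v)
    (pi_exact : forall w, pi w = 0 <-> exists z : 'cV[fps n A]_p, w = T *m z)
    (T_algebraic : forall i j, algebraic_series (T i j))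
    (P : Spec A) (P_finite : (fibre_dim M P < +oo)%E) :
  exists U : set (Spec A), open_nbhs P U /\
    forall Q : Spec A, U Q -> (fibre_dim M Q <= fibre_dim M P)%E.
Proof.
have Ms : spans (fun i => pi (delta_mx i 0)).
  apply: (spans_surj pi_surjective (w := fun i => delta_mx i 0)) => w.
  exists (fun i => w i 0); rewrite {1}(matrix_sum_delta w).
  by apply: eq_bigr => i _; rewrite big_ord1.
have ts (Q : Spec A) m y : exists x, jet_fibre_proj M Q m x = y.
  exact/tensor_map_surj/jet_proj_surj.
have [d [w [dE ws]]] := vdim_fin P_finite.
(* Level d + 1 has d + 1 transition maps below it, one more than a space spanned by d vectors allows
   to be non-injective. *)
have [r [v vs]] := jet_spans d.+1 Ms.
(* The completed fibre at [P] surjects onto this level, so a basis of it gives d spanning vectors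
   there. *)
have evs := spans_surj (f := invlim_ev (t := jet_fibre_proj M P) d.+1)
  (invlim_val_surj (ts P)) ws.
have [g [gP gQ]] := fibre_spans_nbhs (@residue_frac A P) vs evs.
(* The basic open set D(g). *)
exists [set Q | g \notin spec_pred Q]; split.
  split; last by rewrite /= -to_residue_eq0.
  exists [set g]; apply/seteqP; split=> Q /= h.
    by move=> /(_ g erefl); apply/negP.
  by apply/negP => gQ'; apply: h => _ ->.
move=> Q /= gQ0; rewrite /fibre_dim dE.
have [|w' w's] := gQ _ (to_residue Q); first by rewrite to_residue_eq0.
apply: (vdim_invlim_le (ts Q) _ w's) => m.
exact: jet_fibre_proj_inj.
Qed.
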